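(* Let $X$ be a set, let $(R_x)_{x\in X}$ be a family of integral domains, and let $\Lambda=\prod_{x\in X}R_x$. For a maximal ideal $M$ of $\mathcal{P}(X)$ let $M^{\ast}=\{f\in\Lambda: S(f)\in M\}$, where $S(f)=\{x\in X: f_x\neq 0\}$ for $f=(f_x)\in\Lambda$. Then the map $\varphi:\operatorname{Spec}\mathcal{P}(X)\to\operatorname{Min}(\Lambda)$ given by $M\mapsto M^{\ast}$ is a homeomorphism.
   Context: All rings are commutative with $1$. $\mathcal{P}(X)$ denotes the power set ring of $X$: the set of all subsets of $X$ with addition $A+B=(A\cup B)\setminus(A\cap B)$ and multiplication $A\cdot B=A\cap B$; all its prime ideals are maximal. $\operatorname{Spec}$ carries the Zariski topology, and $\operatorname{Min}(\Lambda)$, the set of minimal prime ideals of $\Lambda$, carries the topology induced from the Zariski topology of $\operatorname{Spec}(\Lambda)$. *)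

(* Defs.v *)
From HB Require Import structures.
From mathcomp Require Import all_boot all_algebra.
From mathcomp Require Import all_classical topology.

Set Implicit Arguments.
Unset Strict Implicit.
Unset Printing Implicit Defensive.

Import GRing.Theory.
Local Open Scope classical_set_scope.
Local Open Scope ring_scope.

(* Rings are [comPzRingType] rather than [comNzRingType]: the zero ring has to
   be allowed, since it arises from the empty index set. *)

Section Spectrum.
Variable A : comPzRingType.

Definition ideal (I : set A) : Prop :=
  [/\ I 0, forall x y, I x -> I y -> I (x + y) & forall a x, I x -> I (a * x)].

Definition prime_ideal (P : set A) : Prop :=
  [/\ ideal P, P != setT & forall x y, P (x * y) -> P x \/ P y].

Record Spec : Type := MkSpec {
  spec_set :> set A;
  spec_prime : prime_ideal spec_set }.

Lemma spec_ext (P Q : Spec) : spec_set P = spec_set Q -> P = Q.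
Proof.
case: P Q => [P hP] [Q hQ] /= PQ; subst Q.
by rewrite (Prop_irrelevance hP hQ).
Qed.

HB.instance Definition _ := gen_eqMixin Spec.
HB.instance Definition _ := gen_choiceMixin Spec.

Definition zariski_closed (E : set A) : set Spec := [set P : Spec | E `<=` P].

Definition zariski_open : set_system Spec :=
  [set ~` zariski_closed E | E in setT].

Lemma zariski_openT : zariski_open setT.
Proof.
exists setT => //; apply/seteqP; split=> // P _ /= PT.
by case: (spec_prime P) => _ /eqP + _; apply; apply/seteqP; split.
Qed.

Lemma zariski_openI : setI_closed zariski_open.
Proof.
move=> _ _ [E _ <-] [F _ <-].
exists [set z | exists x y, [/\ E x, F y & z = x * y]] => //.
rewrite -setCU; congr setC; apply/seteqP; split=> P /=.
  move=> EFP; case: (pselect (E `<=` P)) => [|nEP]; [by left|right].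
  move=> y Fy; apply: contrapT => nPy; apply: nEP => x Ex.
  case: (spec_prime P) => _ _ /(_ x y); case=> //.
  by apply: EFP; exists x, y.
case: (spec_prime P) => -[_ _ mulP] _ _ [EP|FP] _ [x [y [Ex Fy ->]]].
  by rewrite mulrC; apply: mulP; apply: EP.
by apply: mulP; apply: FP.
Qed.

Lemma zariski_open_bigU (I : Type) (f : I -> set Spec) :
  (forall i, zariski_open (f i)) -> zariski_open (\bigcup_i f i).
Proof.
move=> /(_ _)/cid2 fo; exists (\bigcup_i s2val (fo i)) => //.
apply/seteqP; split=> P /=.
  move=> nP; apply: contrapT => nfP; apply: nP => x [i _ Ex].
  apply: contrapT => nPx; apply: nfP; exists i => //.
  by rewrite -(s2valP' (fo i)) => /= EP; apply: nPx; exact: EP.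
move=> [i _ fiP] EP; move: fiP; rewrite -(s2valP' (fo i)); apply=> x Ex.
by apply: EP; exists i.
Qed.

HB.instance Definition _ :=
  isOpenTopological.Build Spec zariski_openT zariski_openI zariski_open_bigU.

Definition minimal_primes : set Spec :=
  [set P : Spec | forall Q : Spec, Q `<=` P -> Q = P].

(* [set_type] carries the topology induced by the inclusion into [Spec]. *)
Definition Min : topologicalType := set_type minimal_primes.

End Spectrum.

Definition homeomorphism (S T : topologicalType) (f : S -> T) : Prop :=
  exists g : T -> S, [/\ cancel f g, cancel g f, continuous f & continuous g].

Definition powerset_ring (X : Type) : Type := set X.

Section PowersetRing.
Variable X : Type.

HB.instance Definition _ := Choice.copy (powerset_ring X) (set X).

Let setYNA : left_inverse set0 id (@setY X).
Proof. by move=> A; exact: setYK. Qed.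

(* [setY] is the symmetric difference, A `+` B = (A `|` B) `\` (A `&` B) by
   [setYE]; every element is its own opposite. *)
HB.instance Definition _ := GRing.isZmodule.Build (powerset_ring X)
  (@setYA X) (@setYC X) (@set0Y X) setYNA.

HB.instance Definition _ := GRing.Zmodule_isComPzRing.Build (powerset_ring X)
  (@setIA X) (@setIC X) (@setTI X) (@setIYl X).

End PowersetRing.

Definition prod_ring (X : Type) (R : X -> comPzRingType) : Type :=
  forall x, R x.

Section ProdRing.
Variables (X : Type) (R : X -> comPzRingType).
Local Notation L := (prod_ring R).
Implicit Types f g h : L.

HB.instance Definition _ := Choice.copy L (forall x, R x).

Definition prod_zero : L := fun x => 0.
Definition prod_opp f : L := fun x => - f x.
Definition prod_add f g : L := fun x => f x + g x.
Definition prod_one : L := fun x => 1.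
Definition prod_mul f g : L := fun x => f x * g x.

Let addA : associative prod_add.
Proof. by move=> f g h; apply: functional_extensionality_dep => x; exact: addrA. Qed.
Let addC : commutative prod_add.
Proof. by move=> f g; apply: functional_extensionality_dep => x; exact: addrC. Qed.
Let add0 : left_id prod_zero prod_add.
Proof. by move=> f; apply: functional_extensionality_dep => x; exact: add0r. Qed.
Let addN : left_inverse prod_zero prod_opp prod_add.
Proof. by move=> f; apply: functional_extensionality_dep => x; exact: addNr. Qed.

HB.instance Definition _ := GRing.isZmodule.Build L addA addC add0 addN.

Let mulA : associative prod_mul.
Proof. by move=> f g h; apply: functional_extensionality_dep => x; exact: mulrA. Qed.
Let mulC : commutative prod_mul.
Proof. by move=> f g; apply: functional_extensionality_dep => x; exact: mulrC. Qed.
Let mul1 : left_id prod_one prod_mul.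
Proof. by move=> f; apply: functional_extensionality_dep => x; exact: mul1r. Qed.
Let mulDl : left_distributive prod_mul prod_add.
Proof. by move=> f g h; apply: functional_extensionality_dep => x; exact: mulrDl. Qed.

HB.instance Definition _ := GRing.Zmodule_isComPzRing.Build L mulA mulC mul1 mulDl.

Definition supp f : powerset_ring X := [set x | f x != 0].

Definition star (M : set (powerset_ring X)) : set L := [set f | M (supp f)].

End ProdRing.

(* Main.v *)
Require Import Defs.
From mathcomp Require Import all_boot all_algebra.
From mathcomp Require Import all_classical topology.

(** Everything happens through supports and idempotents.  Over integral domains
    the support turns products into intersections, and supports of sums are
    covered by unions, so the preimage [star M] of a prime [M] of the power set
    ring is a prime of the product ring.  In the other direction, a subset [A]
    gives the idempotent [chi A], its indicator function, and a prime [Q] of the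
    product ring yields the prime [trace Q] of all [A] with [chi A] in [Q].

    Since [supp (chi A) = A], the trace of [star M] is [M].  Since
    [f = f * chi (supp f)], the prime [star (trace Q)] lies below [Q], so it is
    [Q] when [Q] is minimal.  Conversely [star M] is minimal: a prime [Q] below it
    has a trace below [M], hence equal to [M] because the power set ring has no
    proper inclusions between primes, and then [star M = star (trace Q)] is
    contained in [Q].  Thus [star] and [trace] are mutually inverse bijections.
    Each of them is the preimage along a map of the underlying rings ([supp] and
    [chi]); such a map of spectra pulls the closed set of [E] back to the closed
    set of the image of [E], which gives both continuities. *)

Set Implicit Arguments.
Unset Strict Implicit.
Unset Printing Implicit Defensive.

Import GRing.Theory.
Local Open Scope classical_set_scope.
Local Open Scope ring_scope.

(** Only membership enters the Zariski topology, so [t] can be a mere function;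
    it will be [supp] or [chi], which are not additive in general. *)
Lemma continuous_Spec_preimage (A B : comPzRingType) (h : Spec A -> Spec B)
    (t : B -> A) :
  (forall P b, spec_set (h P) b <-> spec_set P (t b)) -> continuous h.
Proof.
move=> hE; apply/continuousP => _ [E _ <-].
exists (t @` E) => //; apply/seteqP; split=> P /= nP EP; apply: nP.
  by move=> _ [b Eb <-]; apply/hE; apply: EP.
by move=> b Eb; apply/hE; apply: EP; exists b.
Qed.

Lemma prime_ideal_not1 (A : comPzRingType) (P : set A) : prime_ideal P -> ~ P 1.
Proof.
case=> -[_ _ PM] /eqP PT _ P1; apply: PT; apply/seteqP; split=> // x _.
by rewrite -(mulr1 x); apply: PM.
Qed.

Section PowersetIdeals.
Variable X : Type.
Implicit Types (M : set (powerset_ring X)) (A B : powerset_ring X).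

Lemma ideal_subset M A B : ideal M -> M B -> A `<=` B -> M A.
Proof. by case=> _ _ MM MB /setIidl <-; apply: (MM A). Qed.

Lemma ideal_setU M A B : ideal M -> M A -> M B -> M (A `|` B).
Proof.
move=> MI MA MB; case: (MI) => _ MD MM.
(* Ring addition agrees with union on disjoint sets. *)
have -> : A `|` B = (A + (B `\` A : powerset_ring X)) :> set X.
  rewrite [RHS]setYE; apply/seteqP; split=> x /=; last by tauto.
  by case: (pselect (A x)); tauto.
by apply: MD => //; apply: (ideal_subset MI MB) => x [].
Qed.

(** Equivalently, primes of the power set ring are maximal: of a set and its
    complement a prime contains exactly one, so none can be enlarged. *)
Lemma powerset_prime_sub_eq (M N : Spec (powerset_ring X)) : N `<=` M -> N = M.
Proof.
move=> NM; apply: spec_ext; apply/seteqP; split=> // A MA.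
have [MI _ _] := spec_prime M; have [[N0 _ _] _ NP] := spec_prime N.
case: (NP A (~` A)) => // [|NcA].
  by have -> : A * (~` A : powerset_ring X) = 0 by exact: setICr.
case: (prime_ideal_not1 (spec_prime M)).
by have := ideal_setU MI MA (NM _ NcA); rewrite setUCr.
Qed.

End PowersetIdeals.

Section Indicator.
Variables (X : Type) (R : X -> comPzRingType).
Implicit Types A B : powerset_ring X.

Lemma prod_ring_ext (f g : prod_ring R) : (forall x, f x = g x) -> f = g.
Proof. exact: functional_extensionality_dep. Qed.

Lemma prod_addE (f g : prod_ring R) x : (f + g) x = f x + g x.
Proof. by []. Qed.

Lemma prod_mulE (f g : prod_ring R) x : (f * g) x = f x * g x.
Proof. by []. Qed.

Definition chi A : prod_ring R := fun x => if `[< A x >] then 1 else 0.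

Lemma chi0 : chi 0 = 0.
Proof. by apply: prod_ring_ext => x; rewrite /chi asboolF. Qed.

Lemma chi1 : chi 1 = 1.
Proof. by apply: prod_ring_ext => x; rewrite /chi asboolT. Qed.

Lemma chiM A B : chi (A * B) = chi A * chi B.
Proof.
apply: prod_ring_ext => x.
rewrite prod_mulE /chi asbool_and.
by case: `[< A x >]; rewrite /= ?mul1r ?mul0r.
Qed.

(** A multiple of [chi A + chi B] suffices to see that traces are closed under
    addition; the factor corrects the value 2 on the intersection. *)
Lemma chiD A B : chi (A + B) = chi (A + B) * (chi A + chi B).
Proof.
apply: prod_ring_ext => x.
rewrite prod_mulE prod_addE /chi.
case: asboolP => [|_]; last by rewrite mul0r.
rewrite mul1r => -[[Ax nBx]|[Bx nAx]].
  by rewrite (asboolT Ax) (asboolF nBx) addr0.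
by rewrite (asboolT Bx) (asboolF nAx) add0r.
Qed.

(** Every element is a multiple of the idempotent of its support, so an ideal is
    at least as large as the idempotents in it dictate; hence every prime lies
    above one of the form [star M]. *)
Lemma mul_chi_supp (f : prod_ring R) : f * chi (supp f) = f.
Proof.
apply: prod_ring_ext => x.
rewrite prod_mulE /chi asboolb.
by case: eqP => [->|_]; rewrite ?mulr0 ?mulr1.
Qed.

Definition trace (Q : set (prod_ring R)) : set (powerset_ring X) :=
  [set A | Q (chi A)].

Lemma trace_prime (Q : set (prod_ring R)) : prime_ideal Q -> prime_ideal (trace Q).
Proof.
move=> QP; case: (QP) => -[Q0 QD QM] _ Qpr; split.
- split; rewrite /trace /=.
  + by rewrite chi0.
  + by move=> A B QA QB; rewrite chiD; apply: QM; apply: QD.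
  + by move=> A B QB; rewrite chiM; apply: QM.
- apply/eqP => QT; case: (prime_ideal_not1 QP); rewrite -chi1.
  by have : trace Q 1 by rewrite QT.
- by move=> A B; rewrite /trace /= chiM; exact: Qpr.
Qed.

Definition trace_Spec (Q : Spec (prod_ring R)) : Spec (powerset_ring X) :=
  MkSpec (trace_prime (spec_prime Q)).

Lemma star_trace_sub (Q : set (prod_ring R)) : ideal Q -> star (trace Q) `<=` Q.
Proof. by case=> _ _ QM f Qf; rewrite -(mul_chi_supp f); apply: QM. Qed.

End Indicator.

Arguments chi {X R} A.

Section Domains.
Variables (X : Type) (R : X -> idomainType).
Local Notation L := (prod_ring (fun x => R x)).
Implicit Types (f g : L) (A : powerset_ring X).

Lemma supp_chi A : supp (chi A : L) = A.
Proof.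
apply/seteqP; split=> x; rewrite /supp /chi /=; case: asboolP => //.
  by rewrite eqxx.
by rewrite oner_eq0.
Qed.

Lemma suppM f g : supp (f * g) = supp f * supp g.
Proof.
apply/seteqP; split=> x.
  by rewrite /supp /= mulf_eq0 negb_or => /andP[].
by case=> fx gx; rewrite /supp /= mulf_neq0.
Qed.

Lemma suppD_sub f g : supp (f + g) `<=` supp f `|` supp g.
Proof.
move=> x; rewrite /supp /= => fgx; apply/orP; apply: contraNT fgx.
rewrite negb_or !negbK => /andP[/eqP fx /eqP gx].
by rewrite prod_addE fx gx addr0.
Qed.

Lemma star_prime (M : set (powerset_ring X)) :
  prime_ideal M -> prime_ideal (star M : set L).
Proof.
move=> MP; case: (MP) => MI _ Mpr; case: (MI) => M0 _ MM; split.
- split; rewrite /star /=.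
  + by rewrite -(chi0 (fun x => R x)) supp_chi.
  + move=> f g Mf Mg.
    exact: (ideal_subset MI (ideal_setU MI Mf Mg) (@suppD_sub f g)).
  + by move=> f g Mg; rewrite suppM; apply: MM.
- apply/eqP => MT; case: (prime_ideal_not1 MP).
  have : star M (chi 1 : L) by rewrite MT.
  by rewrite /star /= supp_chi.
- by move=> f g; rewrite /star /= suppM; exact: Mpr.
Qed.

Definition star_Spec (M : Spec (powerset_ring X)) : Spec L :=
  MkSpec (star_prime (spec_prime M)).

Lemma star_SpecK : cancel star_Spec (@trace_Spec X (fun x => R x)).
Proof.
move=> M; apply: spec_ext; apply/seteqP.
by split=> A; rewrite /= /trace /star /= supp_chi.
Qed.

Lemma star_minimal (M : Spec (powerset_ring X)) : minimal_primes (star_Spec M).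
Proof.
move=> Q QM; have trQ : trace_Spec Q = M.
  apply: powerset_prime_sub_eq; rewrite -[X in _ `<=` spec_set X]star_SpecK.
  by move=> A; exact: QM.
apply: spec_ext; apply/seteqP; split=> //; rewrite -trQ.
by apply: star_trace_sub; case: (spec_prime Q).
Qed.

Lemma minimal_star_trace (Q : Spec L) :
  minimal_primes Q -> star_Spec (trace_Spec Q) = Q.
Proof. by apply; apply: star_trace_sub; case: (spec_prime Q). Qed.

Definition star_Min (M : Spec (powerset_ring X)) : Min L :=
  SigSub (mem_set (@star_minimal M)).

Lemma continuous_star_Min : continuous star_Min.
Proof.
apply: continuous_comp_initial.
by apply: (@continuous_Spec_preimage _ _ _ (@supp X (fun x => R x))).
Qed.

Lemma continuous_trace_Min :
  continuous (fun Q : Min L => trace_Spec (set_val Q)).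
Proof.
move=> Q; apply: continuous_comp; first exact: initial_continuous.
by apply: (@continuous_Spec_preimage _ _ _ (@chi X (fun x => R x))).
Qed.

End Domains.

Theorem theorem6p2 (X : Type) (R : X -> idomainType) :
  exists phi : Spec (powerset_ring X) -> Min (prod_ring (fun x => R x)),
    (forall M : Spec (powerset_ring X),
       spec_set (set_val (phi M)) = star (spec_set M)) /\
    homeomorphism phi.
Proof.
exists (@star_Min X R); split=> [M //|].
exists (fun Q => trace_Spec (set_val Q)); split.
- exact: star_SpecK.
- move=> Q; apply: val_inj; apply: minimal_star_trace.
  exact: set_mem (valP Q).
- exact: continuous_star_Min.
- exact: continuous_trace_Min.
Qed.
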